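(* Let $n\in\mathbb{N}$ and let $M$ be an $n\times n$ symmetric random matrix which satisfies, for some constant $1\le C<\infty$ and some $\sigma$-algebras $\mathcal{F}_1,\dots,\mathcal{F}_{n-1}$ as described in the context, the anti-concentration condition (1) and the base condition (2) of the context. Then $$\mathbb{P}\big[\,|\det M|<(4Cn)^{-4(n+1)}\,\big]\le\frac{3}{n}.$$
   Context: For $1\le i\le n-1$, $\mathcal{F}_i$ is a $\sigma$-algebra (on the underlying probability space) with respect to which the entry $M[k,\ell]$ is measurable for all $(k,\ell)$ satisfying either $i\le k$ and $i+2\le\ell$, or $k=\ell\in\{i,i+1\}$. Conditional probabilities given $\mathcal{F}_i$ of events involving $M[i,i+1]$ are computed from a regular conditional distribution of $M[i,i+1]$ given $\mathcal{F}_i$. Let $\mathcal{R}(C)=\{(\alpha,\epsilon):\ \alpha>0,\ \epsilon\ge(4C^2n^4)^{-1}\alpha\}$. The conditions are: (1) For every $1\le i\le n-1$, with probability greater than $1-n^{-2}$, the following holds simultaneously for all $x\in\mathbb{R}$, $\beta\in\mathbb{R}$ and $(\alpha,\epsilon)\in\mathcal{R}(C)$: $$\mathbb{P}\big[\,|\alpha M[i,i+1]^2+\beta M[i,i+1]-x|<\epsilon\ \big|\ \mathcal{F}_i\big]<\frac{4C\sqrt{\epsilon}}{\sqrt{\alpha}}+n^{-2}.$$ (2) If $n$ is odd, $\mathbb{P}[|M[n,n]|<(4Cn)^{-4}]\le n^{-2}$; if $n$ is even, $\mathbb{P}\big[\,|M[n-1,n-1]M[n,n]-M[n-1,n]^2|<(4Cn)^{-4}\big]\le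 n^{-2}$. *)

(* Defs.v *)
From HB Require Import structures.
From mathcomp Require Import all_boot all_order all_algebra.
From mathcomp Require Import all_classical all_reals all_analysis.

Set Implicit Arguments.
Unset Strict Implicit.
Unset Printing Implicit Defensive.

Import Order.TTheory GRing.Theory Num.Theory.
Import numFieldNormedType.Exports.

Local Open Scope classical_set_scope.
Local Open Scope ring_scope.

(* The indices i = 1, ..., n-1 are the elements of 'I_n.-1, shifted down by
   one; i and i+1, seen as indices of an n x n matrix, are [cur i], [nxt i]. *)
Definition cur n (i : 'I_n.-1) : 'I_n := widen_ord (leq_pred n) i.

Lemma nxt_subproof n (i : 'I_n.-1) : (i.+1 < n)%N.
Proof. by rewrite -ltn_predRL. Qed.

Definition nxt n (i : 'I_n.-1) : 'I_n := Ordinal (nxt_subproof i).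

Section random_matrix.
Context d (T : measurableType d) (R : realType) (P : probability T R).

Definition random_matrix n (M : T -> 'M[R]_n) : Prop :=
  forall k l : 'I_n, measurable_fun [set: T] (fun w => M w k l).

Definition is_sub_sigma_algebra (F : set (set T)) : Prop :=
  sigma_algebra [set: T] F /\ F `<=` measurable.

(* [g_sigma_algebraType F] is the type [T] with the sigma-algebra generated by
   [F], which is [F] itself when [F] is a sigma-algebra. *)
Definition measurable_wrt (F : set (set T)) (X : T -> R) : Prop :=
  measurable_fun [set: g_sigma_algebraType F] X.

(* The kernel type already makes [kappa ^~ B] measurable with respect to [F]
   and [kappa w] a probability. *)
Definition regular_conditional_distribution (F : set (set T)) (X : T -> R)
    (kappa : R.-pker (g_sigma_algebraType F) ~> R) : Prop :=
  forall (A : set T) (B : set R), F A -> measurable B ->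
    P (A `&` X @^-1` B) = (\int[P]_(w in A) kappa w B)%E.

Definition region n (C : R) : set (R * R) :=
  [set p | 0 < p.1 /\ (4 * C ^+ 2 * n%:R ^+ 4)^-1 * p.1 <= p.2].

(* "With probability greater than 1 - n^-2" is witnessed by a measurable event
   [E], since the set of the [w] satisfying the uncountably many inequalities
   is not known in advance to be measurable. *)
Definition anti_concentration n (C : R) (F : 'I_n.-1 -> set (set T))
    (kappa : forall i : 'I_n.-1,
      R.-pker (g_sigma_algebraType (F i)) ~> R) : Prop :=
  forall i : 'I_n.-1, exists E : set T,
    [/\ measurable E,
        ((1 - n%:R ^- 2)%:E < P E)%E &
        forall w, E w -> forall x beta alpha eps : R,
          region n C (alpha, eps) ->
          (kappa i w [set y : R | (`|alpha * y ^+ 2 + beta * y - x| < eps)%R]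
             < (4 * C * Num.sqrt eps / Num.sqrt alpha + n%:R ^- 2)%:E)%E].

Definition base_condition n (C : R) (M : T -> 'M[R]_n) : Prop :=
  (odd n -> forall l : 'I_n, l.+1 = n ->
    (P [set w | (`|M w l l| < (4 * C * n%:R) ^- 4)%R] <= (n%:R ^- 2)%:E)%E) /\
  (~~ odd n -> forall k l : 'I_n, k.+2 = n -> l.+1 = n ->
    (P [set w | (`|M w k k * M w l l - M w k l ^+ 2| < (4 * C * n%:R) ^- 4)%R]
       <= (n%:R ^- 2)%:E)%E).

End random_matrix.

(* Main.v *)
Require Import Defs.
From HB Require Import structures.
From mathcomp Require Import all_boot all_order perm all_algebra.
From mathcomp Require Import all_classical all_reals all_analysis.
From mathcomp Require Import measurable_realfun ring lra zify.

Set Implicit Arguments.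
Unset Strict Implicit.
Unset Printing Implicit Defensive.

Import Order.TTheory GRing.Theory Num.Theory.
Import numFieldNormedType.Exports.

Local Open Scope classical_set_scope.
Local Open Scope ring_scope.

(** Let [D i] be the determinant of the principal submatrix of [M] on the
    indices [>= i] (counted from 0), so that [D 0 = \det M]. Regarded as a
    function of the single entry [y = M i (i+1) = M (i+1) i], it is a quadratic
    polynomial [- D (i+2) * y ^+ 2 + b * y + c] ([det_trailing_quadratic]), and
    [b], [c] and [D (i+2)] involve only entries that are measurable with respect
    to [F i]. Conditionally on [F i] those numbers are frozen while [y] follows
    [kappa i], so the anti-concentration hypothesis with [alpha = |D (i+2)|] and
    [eps = delta * alpha], where [delta = (4 C^2 n^4)^-1] is the least ratio it
    allows, bounds the conditional probability of [|D i| < delta * |D (i+2)|] by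
    [4 C sqrt delta + n^-2 = 3 n^-2] on an event of probability [> 1 - n^-2].
    Integrating, [|D i| < delta * |D (i+2)|] has probability at most [4 n^-2]
    ([probability_trailing_drop]).

    The base condition says that [|D i|] is at least [(4 C n)^-4] outside an
    event of probability [n^-2], for the even index [i] equal to [n-1] or [n-2].
    Descending from there to 0 by steps of 2 takes [m <= (n-1)/2] steps, each
    losing a factor [delta >= (4 C n)^-4] and a probability [4 n^-2]. Hence
    [|\det M| >= (4 C n)^(-4 (m+1))] outside an event of probability at most
    [(1 + 4 m) n^-2 <= 3 / n].

    The passage from the conditional to the unconditional probability is the
    disintegration formula ([disintegration]): an event that depends jointly on
    [F i] and on [y] has probability equal to the integral of the [kappa i]
    measure of its sections. *)

(** * Trailing principal minors *)

Section trailing_minors.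
Variable R : comNzRingType.

(** In the Leibniz expansion a permutation that moves some index of [S]
    contributes zero, and one that fixes [S] pointwise never meets the columns
    of [S] in the other rows. *)
Lemma det_unit_rows n (S : pred 'I_n) (A B : 'M[R]_n) :
  (forall k l, S k -> A k l = (k == l)%:R) ->
  (forall k l, S k -> B k l = (k == l)%:R) ->
  (forall k l, ~~ S k -> ~~ S l -> A k l = B k l) ->
  \det A = \det B.
Proof.
move=> AS BS AB; apply: eq_bigr => s _; congr (_ * _).
have [/existsP[k /andP[Sk skk]]|/existsPn fixS] :=
    boolP [exists k, S k && (s k != k)].
  rewrite (bigD1 k)//= [in RHS](bigD1 k)//= AS// BS//.
  by rewrite eq_sym (negPf skk) !mul0r.
apply: eq_bigr => k _; have [Sk|nSk] := boolP (S k); first by rewrite AS// BS.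
apply: AB => //; apply/negP => Ssk; have := fixS (s k).
by rewrite Ssk negbK => /eqP/perm_inj skk; rewrite skk (negPf nSk) in Ssk.
Qed.

Definition set_rows n (p q : 'I_n) (u v : 'rV[R]_n) (A : 'M[R]_n) : 'M[R]_n :=
  \matrix_(k, l) if k == p then u 0 l else if k == q then v 0 l else A k l.

Definition set_sym_entry n (p q : 'I_n) (y : R) (A : 'M[R]_n) : 'M[R]_n :=
  \matrix_(k, l)
    if (k == p) && (l == q) || (k == q) && (l == p) then y else A k l.

Lemma det_set_rows_linear_l n (p q : 'I_n) y u u' v (A : 'M[R]_n) :
  \det (set_rows p q (u + y *: u') v A) =
  \det (set_rows p q u v A) + y * \det (set_rows p q u' v A).
Proof.
rewrite -(mul1r (\det (set_rows p q u v A))).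
apply: (determinant_multilinear (i0 := p)).
- by apply/rowP => l; rewrite !mxE !eqxx mul1r.
- by apply/matrixP => k l; rewrite !mxE eq_sym (negPf (neq_lift _ _)).
- by apply/matrixP => k l; rewrite !mxE eq_sym (negPf (neq_lift _ _)).
Qed.

Lemma set_rowsC n (p q : 'I_n) u v (A : 'M[R]_n) : p != q ->
  set_rows p q u v A = set_rows q p v u A.
Proof.
move=> pq; apply/matrixP => k l; rewrite !mxE.
by have [->|//] := eqVneq k p; rewrite (negPf pq).
Qed.

Lemma det_set_rows_linear_r n (p q : 'I_n) y u v v' (A : 'M[R]_n) : p != q ->
  \det (set_rows p q u (v + y *: v') A) =
  \det (set_rows p q u v A) + y * \det (set_rows p q u v' A).
Proof. by move=> pq; rewrite !(set_rowsC _ _ _ pq) det_set_rows_linear_l. Qed.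

Lemma det_set_rows_swap n (p q : 'I_n) u v (A : 'M[R]_n) : p != q ->
  \det (set_rows p q v u A) = - \det (set_rows p q u v A).
Proof.
move=> pq; rewrite -mulN1r -[-1]expr1.
have -> : (-1 : R) ^+ 1 = \det (tperm_mx p q : 'M[R]_n).
  by rewrite det_perm odd_tperm pq.
rewrite -det_mulmx -xrowE; congr (\det _); apply/matrixP => k l; rewrite !mxE.
case: tpermP => [->|->|/eqP/negPf -> /eqP/negPf -> //].
  by rewrite !eqxx [q == p]eq_sym (negPf pq).
by rewrite !eqxx [q == p]eq_sym (negPf pq).
Qed.

(** The two occurrences of [y] lie in different rows, so bilinearity in these
    rows gives a quadratic polynomial. Its leading coefficient is the minor in
    which the rows [p] and [q] are the unit vectors of [q] and of [p], and
    exchanging them gives the sign. *)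
Lemma det_set_sym_entry n (p q : 'I_n) (A : 'M[R]_n) : p != q ->
  exists b c : R, forall y, \det (set_sym_entry p q y A) =
    b * y + c - y ^+ 2 * \det (set_rows p q (delta_mx 0 p) (delta_mx 0 q) A).
Proof.
move=> pq; pose u := row p (set_sym_entry p q 0 A).
pose v := row q (set_sym_entry p q 0 A).
exists (\det (set_rows p q (delta_mx 0 q) v A) +
        \det (set_rows p q u (delta_mx 0 p) A)).
exists (\det (set_rows p q u v A)) => y.
have -> : set_sym_entry p q y A =
    set_rows p q (u + y *: delta_mx 0 q) (v + y *: delta_mx 0 p) A.
  apply/matrixP => k l; rewrite !mxE !eqxx /= [q == p]eq_sym (negPf pq) /=.
  have [->|kp] := eqVneq k p; rewrite ?(negPf pq) ?eqxx ?orbF /=.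
    by case: (l == q); rewrite ?mulr1 ?add0r // mulr0 addr0.
  have [->|kq //] := eqVneq k q; rewrite ?eqxx /=.
  by case: (l == p); rewrite ?mulr1 ?add0r // mulr0 addr0.
rewrite det_set_rows_linear_l !det_set_rows_linear_r //.
rewrite (det_set_rows_swap (delta_mx 0 p) (delta_mx 0 q) _ pq); ring.
Qed.

(** Filling up with the identity keeps the size [n] fixed while [i] varies: the
    determinant is that of the principal submatrix on the indices [>= i]. *)
Definition trailing n (i : nat) (A : 'M[R]_n) : 'M[R]_n :=
  \matrix_(k, l) if (i <= k)%N && (i <= l)%N then A k l else (k == l)%:R.

Lemma trailing0 n (A : 'M[R]_n) : trailing 0 A = A.
Proof. by apply/matrixP => k l; rewrite mxE. Qed.

Lemma det_trailing_block p q (A : 'M[R]_(p + q)) :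
  \det (trailing p A) = \det (drsubmx A).
Proof.
have -> : trailing p A = block_mx 1%:M 0 0 (drsubmx A).
  rewrite -[LHS]submxK; congr block_mx; apply/matrixP => k l; rewrite !mxE /=.
  - by rewrite leqNgt ltn_ord.
  - by rewrite leqNgt ltn_ord/= eq_lrshift.
  - by rewrite leq_addr leqNgt ltn_ord eq_rlshift.
  - by rewrite !leq_addr.
by rewrite det_ublock det1 mul1r.
Qed.

Lemma det_trailing_last n (A : 'M[R]_n) (l : 'I_n) : l.+1 = n ->
  \det (trailing l A) = A l l.
Proof.
move pl: (nat_of_ord l) => p; rewrite -addn1 => pn.
case: n / pn in A l pl *.
rewrite det_trailing_block det_mx11 !mxE.
by have -> : l = rshift p ord0 by apply: val_inj; rewrite /= addn0 pl.
Qed.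

Lemma det_mx22 (A : 'M[R]_2) :
  \det A = A ord0 ord0 * A ord_max ord_max - A ord0 ord_max * A ord_max ord0.
Proof.
rewrite (expand_det_row _ ord0) !big_ord_recl big_ord0 /cofactor !det_mx11 !mxE.
have l01 (j : 'I_1) : lift ord0 j = ord_max :> 'I_2.
  by apply: val_inj; rewrite /= (ord1 j).
have l10 (j : 'I_1) : lift ord_max j = ord0 :> 'I_2.
  by apply: val_inj; rewrite /= (ord1 j).
by rewrite !(l01, l10) /=; ring.
Qed.

Lemma det_trailing_last2 n (A : 'M[R]_n) (k l : 'I_n) : k.+2 = n -> l.+1 = n ->
  \det (trailing k A) = A k k * A l l - A k l * A l k.
Proof.
move pk: (nat_of_ord k) => p; rewrite -addn2 => pn.
case: n / pn in A k l pk * => lE.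
have lp : l = p.+1 :> nat by apply: succn_inj; rewrite lE addn2.
have -> : k = rshift p ord0 by apply: val_inj; rewrite /= addn0 pk.
have -> : l = rshift p ord_max by apply: val_inj; rewrite /= addn1 lp.
by rewrite det_trailing_block det_mx22 !mxE.
Qed.

(** The leading coefficient is the minor two steps further, since the unit rows
    at [i] and [i+1] can be treated as part of the identity block. *)
Lemma det_trailing_quadratic n (A : 'M[R]_n) (i : 'I_n.-1) :
  exists b c : R, forall y,
    \det (trailing i (set_sym_entry (cur i) (nxt i) y A)) =
      b * y + c - y ^+ 2 * \det (trailing i.+2 A).
Proof.
have cn : cur i != nxt i by rewrite -val_eqE /= neq_ltn ltnSn.
have [b [c bc]] := det_set_sym_entry (trailing i A) cn.
exists b, c => y.
have -> : trailing i (set_sym_entry (cur i) (nxt i) y A) =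
    set_sym_entry (cur i) (nxt i) y (trailing i A).
  apply/matrixP => k l; rewrite !mxE.
  have [|//] := boolP ((k == cur i) && (l == nxt i) || _).
  by case/orP => /andP[/eqP-> /eqP->] /=; rewrite leqnn leqnSn.
rewrite bc; congr (_ - _ * _).
apply: (@det_unit_rows _ (fun k => k < i.+2)%N).
- move=> k l ki; rewrite !mxE eqxx /=.
  have [->|kc] := eqVneq k (cur i); first by rewrite eq_sym.
  have [->|kn] := eqVneq k (nxt i); first by rewrite eq_sym.
  suff -> : (i <= k)%N = false by [].
  by move: ki kc kn; rewrite -!val_eqE /= ltnS leq_eqVlt => /orP[->//|];
    rewrite ltnS leq_eqVlt => /orP[->//|]; rewrite ltnNge => /negPf.
- by move=> k l ki; rewrite mxE leqNgt ki.
- move=> k l; rewrite -!leqNgt !mxE => ki li; rewrite ki li.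
  rewrite -!val_eqE /= (gtn_eqF (ltnW ki)) (gtn_eqF ki).
  by rewrite (ltnW (ltnW ki)) (ltnW (ltnW li)).
Qed.

End trailing_minors.

(** * Measurability *)

Lemma measurable_det d (T : measurableType d) (R : realType) n
    (A : T -> 'M[R]_n) :
  (forall k l, measurable_fun [set: T] (fun w => A w k l)) ->
  measurable_fun [set: T] (fun w => \det (A w)).
Proof.
move=> mA; rewrite /determinant; apply: measurable_sum => s.
apply: measurable_funM; first exact: measurable_cst.
by apply: measurable_prod => i _; exact: mA.
Qed.

Lemma measurable_ltr d (T : measurableType d) (R : realType) (f g : T -> R) :
  measurable_fun [set: T] f -> measurable_fun [set: T] g ->
  measurable [set w | f w < g w].
Proof.
move=> mf mg.
have := measurable_fun_ltr mf mg measurableT (Logic.I : measurable [set true]).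
by rewrite setTI.
Qed.

Lemma measurable_trailing d (T : measurableType d) (R : realType) n
    (A : T -> 'M[R]_n) i :
  (forall k l : 'I_n, (i <= k)%N -> (i <= l)%N ->
     measurable_fun [set: T] (fun w => A w k l)) ->
  measurable_fun [set: T] (fun w => \det (trailing i (A w))).
Proof.
move=> mA; apply: measurable_det => k l.
under eq_fun do rewrite mxE.
have [/andP[ik il]|_] := boolP ((i <= k)%N && (i <= l)%N); first exact: mA.
exact: measurable_cst.
Qed.

(** * Conditioning on a sub-sigma-algebra *)

Section conditioning.
Context d (T : measurableType d) (R : realType) (P : probability T R).
Variable (F : set (set T)).
Hypothesis F_sigma : is_sub_sigma_algebra F.

Lemma measurable_g_sigma (A : set T) :
  @measurable _ (g_sigma_algebraType F) A -> F A.
Proof. by case: F_sigma => sF _; rewrite /measurable /= sigma_algebra_id. Qed.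

Lemma measurable_fun_from_sub d' (U : measurableType d') (f : T -> U) :
  @measurable_fun _ _ (g_sigma_algebraType F) U setT f ->
  measurable_fun [set: T] f.
Proof.
move=> mf _ Y mY; have := mf measurableT Y mY.
by move=> /measurable_g_sigma; case: F_sigma => _; exact.
Qed.

Variables (X : T -> R) (kappa : R.-pker (g_sigma_algebraType F) ~> R).
Hypotheses (mX : measurable_fun [set: T] X)
  (rcd : regular_conditional_distribution P X kappa).

Lemma measurable_graph :
  measurable_fun [set: T] (fun w => ((w : g_sigma_algebraType F), X w)).
Proof.
apply/measurable_fun_pairP; split => //=.
by apply: measurable_fun_from_sub; exact: measurable_id.
Qed.

Lemma measurable_kernel_section (S : set (g_sigma_algebraType F * R)) :
  measurable S ->
  measurable_fun [set: T] (fun w => kappa w (xsection S w) : \bar R).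
Proof.
move=> mS; apply: measurable_fun_from_sub.
by apply: measurable_fun_xsection_finite_kernel; rewrite inE.
Qed.

(** Both sides are finite measures in [S]. They agree on rectangles, by the
    definition of a regular conditional distribution, and hence on the
    sigma-algebra that the rectangles generate. *)
Lemma disintegration (S : set (g_sigma_algebraType F * R)) : measurable S ->
  P [set w : T | S ((w : g_sigma_algebraType F), X w)] =
  (\int[P]_w kappa w (xsection S w))%E.
Proof.
pose G (S : set (g_sigma_algebraType F * R)) : set T :=
  [set w : T | S ((w : g_sigma_algebraType F), X w)].
have mG U : measurable U -> measurable (G U).
  by move=> mU; have := measurable_graph measurableT mU; rewrite setTI.
rewrite -/(G S) {1}measurable_prod_measurableType; move: S.
apply: dynkin_induction => /=.
- by rewrite measurable_prod_measurableType.
- move=> _ _ [A1 mA1 [A2 mA2 <-]] [B1 mB1 [B2 mB2 <-]].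
  exists (A1 `&` B1); first exact: measurableI.
  exists (A2 `&` B2); first exact: measurableI.
  by rewrite setXI.
- rewrite (_ : G _ = setT) //.
  rewrite (_ : P setT = 1%E); last exact: probability_setT.
  under eq_integral => w _ do rewrite xsectionE preimage_setT prob_kernel.
  by rewrite integral_cst// mul1e; exact/esym/probability_setT.
- move=> _ [A mA [B mB <-]].
  rewrite (_ : G _ = A `&` X @^-1` B) //.
  rewrite rcd//; last exact: measurable_g_sigma.
  rewrite integral_mkcond; apply: eq_integral => w _.
  rewrite patchE; case: ifPn => wA; first by rewrite in_xsectionX.
  by rewrite notin_xsectionX// measure0.
- move=> S mS IS; rewrite (_ : G _ = ~` G S)//.
  rewrite probability_setC; last exact: mG.
  have mk := measurable_kernel_section mS.
  have mkC := measurable_kernel_section (measurableC mS).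
  have k1 (w : g_sigma_algebraType F) :
      (kappa w (xsection S w) + kappa w (xsection (~` S) w) = 1)%E.
    have mSw := measurable_xsection w mS.
    have mCw := measurable_xsection w (measurableC mS).
    rewrite -(measureU _ mSw mCw) !xsectionE preimage_setC ?setICr// setUCr.
    exact: prob_kernel.
  have PS1 : (P (G S) + \int[P]_w kappa w (xsection (~` S) w) = 1)%E.
    rewrite IS -ge0_integralD//.
    under eq_integral => w _ do rewrite k1.
    by rewrite integral_cst// mul1e; exact: probability_setT.
  by rewrite -PS1 addeAC subee ?add0e// fin_num_measure//; exact: mG.
- move=> H mH tH IH.
  rewrite (_ : G _ = \bigcup_k G (H k))//.
  rewrite measure_semi_bigcup//; last 3 first.
  - by move=> i; exact: mG.
  - move=> i j _ _ [w [Hi Hj]]; apply: (tH i j) => //.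
    by exists ((w : g_sigma_algebraType F), X w).
  - by apply: bigcup_measurable => k _; exact: mG.
  rewrite (eq_eseriesr (fun k _ => IH k)) -integral_nneseries//; last first.
    by move=> k; exact: measurable_kernel_section.
  apply: eq_integral => w _.
  rewrite xsection_bigcup measure_semi_bigcup//.
  - by move=> k; exact: measurable_xsection.
  - move=> i j _ _ [y []]; rewrite !xsectionE => Hi Hj.
    by apply: (tH i j) => //; exists ((w : g_sigma_algebraType F), y).
  - by apply: bigcup_measurable => k _; exact: measurable_xsection.
Qed.

(** Outside [E] the section is only known to have measure at most 1. *)
Lemma probability_le_section (S : set (g_sigma_algebraType F * R)) (E : set T)
    (e1 e2 : R) :
  measurable S -> measurable E -> 0 <= e1 -> ((1 - e2)%:E < P E)%E ->
  (forall w, E w -> (kappa w (xsection S w) <= e1%:E)%E) ->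
  (P [set w : T | S ((w : g_sigma_algebraType F), X w)] <= (e1 + e2)%:E)%E.
Proof.
move=> mS mE e1_ge0 PE kE; rewrite (disintegration mS).
have mk := measurable_kernel_section mS.
rewrite -(setvU E) ge0_integral_setU//; last 3 first.
- exact: measurableC.
- by rewrite setvU.
- by rewrite disj_set2E setICl.
rewrite addeC EFinD; apply: leeD.
  apply: (@le_trans _ _ (\int[P]_(w in E) cst e1%:E w)%E).
    by apply: ge0_le_integral => //; exact: measurable_funTS.
  rewrite integral_cst//; apply: (@le_trans _ _ (e1%:E * 1)%E).
    by apply: lee_wpmul2l; [rewrite lee_fin|exact: probability_le1].
  by rewrite mule1.
apply: (@le_trans _ _ (\int[P]_(w in ~` E) cst 1%E w)%E).
  apply: ge0_le_integral => //; [exact: measurableC|exact: measurable_funTS|].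
  move=> w _; rewrite -(@prob_kernel _ _ _ _ _ kappa w).
  by apply: le_measure; rewrite ?inE//; exact: measurable_xsection.
rewrite integral_cst ?mul1e; last exact: measurableC.
apply: (@le_trans _ _ (1 - P E)%E); first by rewrite -probability_setC.
have : P E \is a fin_num by exact: fin_num_measure.
move: PE; case: (P E) => // r; rewrite lte_fin lee_fin => PE _.
by rewrite lerBlDr addrC -lerBlDr ltW.
Qed.

End conditioning.

(** * The descent *)

(** Multiplying by the sign of [- a] makes the leading coefficient positive, as
    the anti-concentration hypothesis requires. *)
Lemma norm_quadratic (R : realType) (a b c y : R) : a != 0 ->
  `|b * y + c - y ^+ 2 * a| =
  `| `|a| * y ^+ 2 + (- (Num.sg a * b)) * y - Num.sg a * c|.
Proof.
move=> a0; rewrite -[LHS]mul1r -[X in X * _](_ : `|- Num.sg a| = 1); last first.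
  by rewrite normrN normr_sg a0.
by rewrite -normrM [X in _ = `|X * _ + _ - _|]normrEsg; congr (`|_|); ring.
Qed.

(** A union bound over the [m] steps: if every ratio of consecutive terms is at
    least [delta], the lower bound [b] on [D m.*2] is inherited by [D 0]
    up to the factor [delta ^+ m]. *)
Lemma probability_descent d (T : measurableType d) (R : realType)
    (P : probability T R) (D : nat -> T -> R) (m : nat) (delta b e0 e : R) :
  (forall i, measurable_fun [set: T] (D i)) ->
  0 < delta ->
  (P [set w | (`|D m.*2 w| < b)%R] <= e0%:E)%E ->
  (forall j, (j < m)%N ->
    (P [set w | (`|D j.*2 w| < delta * `|D j.+1.*2 w|)%R] <= e%:E)%E) ->
  (P [set w | (`|D 0%N w| < delta ^+ m * b)%R] <= (e0 + m%:R * e)%:E)%E.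
Proof.
move=> mD delta_gt0 base step.
have mlt f g : measurable_fun [set: T] f -> measurable_fun [set: T] g ->
    measurable [set w : T | (`|f w : R| < g w)%R].
  by move=> mf mg; apply: measurable_ltr => //; exact: measurableT_comp.
suff H j : (j <= m)%N ->
    (P [set w | (`|D (m - j).*2 w| < delta ^+ j * b)%R]
       <= (e0 + j%:R * e)%:E)%E by have := H m (leqnn m); rewrite subnn.
elim: j => [_|j IH jm]; first by rewrite subn0 expr0 mul1r mul0r addr0.
have sj : (m - j = (m - j.+1).+1)%N by lia.
have := IH (ltnW jm); rewrite sj => IHj.
have := step (m - j.+1)%N.
rewrite ltn_subrL (leq_ltn_trans _ jm)// => /(_ isT) stepj.
set i := (m - j.+1)%N in IHj stepj *.
set A := [set w | _] in IHj; set B := [set w | _] in stepj.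
have mA : measurable A by exact: mlt.
have mB : measurable B.
  by apply: mlt => //; apply: measurable_funM => //; exact: measurableT_comp.
apply: (@le_trans _ _ (P (A `|` B))).
  apply: le_measure; rewrite ?inE; [exact: mlt|exact: measurableU|].
  move=> w /= lt1.
  have [?|ge1] := ltP `|D i.+1.*2 w| (delta ^+ j * b); [by left|right].
  by apply: lt_le_trans lt1 _; rewrite exprS -mulrA ler_pM2l.
apply: (@le_trans _ _ (P A + P B)%E); first exact: measureU2.
apply: le_trans (leeD IHj stepj) _; rewrite -EFinD lee_fin -natr1.
lra.
Qed.

Section anti_concentrated_matrix.
Context d (T : measurableType d) (R : realType) (P : probability T R).
Variables (n : nat) (n_gt0 : (0 < n)%N) (M : T -> 'M[R]_n).
Hypotheses (M_random : random_matrix M) (M_sym : forall w, (M w)^T = M w).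
Variables (C : R) (C_ge1 : 1 <= C) (F : 'I_n.-1 -> set (set T)).
Hypotheses (F_sigma : forall i, is_sub_sigma_algebra (F i))
  (F_meas : forall (i : 'I_n.-1) (k l : 'I_n),
     ((i <= k)%N /\ (i + 2 <= l)%N) \/
     (k = l /\ (k = cur i \/ k = nxt i)) ->
     measurable_wrt (F i) (fun w => M w k l)).
Variable kappa : forall i : 'I_n.-1, R.-pker (g_sigma_algebraType (F i)) ~> R.
Hypotheses (kappa_rcd : forall i : 'I_n.-1,
     regular_conditional_distribution P
       (fun w => M w (cur i) (nxt i)) (kappa i))
  (M_anti : anti_concentration P C kappa).

(** Symmetry supplies the entries of the columns [i] and [i+1] below the row
    [i+1]: the hypothesis on [F i] covers only their transposes. *)
Lemma entry_measurable_wrt (i : 'I_n.-1) (k l : 'I_n) :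
  (i <= k)%N -> (i <= l)%N ->
  ~~ ((k == cur i) && (l == nxt i) || (k == nxt i) && (l == cur i)) ->
  measurable_wrt (F i) (fun w => M w k l).
Proof.
rewrite -!val_eqE /= => ik il.
have [il2 _|li2] := leqP (i + 2) l; first by apply: F_meas; left.
have [ik2 _|ki2 nkl] := leqP (i + 2) k.
  rewrite (_ : (fun w => M w k l) = (fun w => M w l k)); last first.
    by apply/funext => w; rewrite -[in LHS]M_sym mxE.
  by apply: F_meas; left.
apply: F_meas; right; have kl : k = l by apply: val_inj => /=; lia.
split => //; have [ki|ki] := eqVneq (k : nat) i.
  by left; apply: val_inj.
by right; apply: val_inj => /=; lia.
Qed.

Let delta : R := (4 * C ^+ 2 * n%:R ^+ 4)^-1.

Lemma sqrt_delta : 4 * C * Num.sqrt delta = 2 / n%:R ^+ 2.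
Proof.
have n0 : n%:R != 0 :> R by rewrite pnatr_eq0 -lt0n.
have C0 : C != 0 by rewrite gt_eqF// (lt_le_trans _ C_ge1).
have -> : delta = (2 * C * n%:R ^+ 2)^-1 ^+ 2.
  by rewrite /delta; field; rewrite n0 C0.
rewrite sqrtr_sqr ger0_norm; first by field; rewrite n0 C0.
by rewrite invr_ge0 !mulr_ge0// (le_trans _ C_ge1).
Qed.

Lemma delta_gt0 : 0 < delta.
Proof.
have C_gt0 : 0 < C by exact: lt_le_trans C_ge1.
by rewrite invr_gt0 !pmulr_rgt0 ?exprn_gt0 ?ltr0n.
Qed.

(** The conditional estimate requires a nonzero leading coefficient; where it
    vanishes the event is empty, because the inequality is strict. *)
Lemma probability_trailing_drop (i : 'I_n.-1) :
  (P [set w | (`|\det (trailing i (M w))| <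
               delta * `|\det (trailing i.+2 (M w))|)%R]
     <= (4 / n%:R ^+ 2)%:E)%E.
Proof.
pose f (p : g_sigma_algebraType (F i) * R) : R :=
  \det (trailing i (set_sym_entry (cur i) (nxt i) p.2 (M p.1))).
pose a (w : g_sigma_algebraType (F i)) : R := \det (trailing i.+2 (M w)).
have mf : measurable_fun setT f.
  apply: measurable_trailing => k l ik il; under eq_fun do rewrite mxE.
  have [_|kl] :=
      boolP ((k == cur i) && (l == nxt i) || (k == nxt i) && (l == cur i)).
    exact: measurable_snd.
  exact: (measurableT_comp (entry_measurable_wrt ik il kl) measurable_fst).
have ma : measurable_fun setT a.
  apply: measurable_trailing => k l ik il.
  by apply: F_meas; left; split; lia.
pose S := [set p : g_sigma_algebraType (F i) * R | `|f p| < delta * `|a p.1| ].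
have mS : measurable S.
  apply: measurable_ltr; first exact: measurableT_comp.
  apply: measurable_funM => //.
  apply: measurableT_comp => //.
  by apply: (measurableT_comp ma); exact: measurable_fst.
have -> : [set w | (`|\det (trailing i (M w))| <
               delta * `|\det (trailing i.+2 (M w))|)%R] =
    [set w : T | S ((w : g_sigma_algebraType (F i)), M w (cur i) (nxt i))].
  apply/seteqP; split => w /=; rewrite /S /f /a /=;
  rewrite (_ : set_sym_entry _ _ _ _ = M w)//;
  apply/matrixP => k l; rewrite !mxE;
  case: ifPn => // /orP[]/andP[/eqP-> /eqP->] //;
  by rewrite -[in LHS]M_sym mxE.
have [E [mE PE HE]] := M_anti i.
(* 3 n^-2 for the conditional bound on [E], n^-2 for the complement of [E]. *)
rewrite (_ : 4 / n%:R ^+ 2 = 3 / n%:R ^+ 2 + n%:R ^- 2); last first.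
  by field; rewrite pnatr_eq0 -lt0n.
apply: (probability_le_section (F_sigma i) (M_random _ _) (@kappa_rcd i) mS mE).
- by rewrite divr_ge0.
- exact: PE.
move=> w Ew; have [b [c bc]] := det_trailing_quadratic (M w) i.
have [aw0|aw0] := eqVneq (a w) 0.
  rewrite (_ : xsection S w = set0) ?measure0 ?lee_fin ?divr_ge0//.
  apply/seteqP; split => y //; rewrite xsectionE /S /= aw0 normr0 mulr0.
  by rewrite ltNge normr_ge0.
rewrite (_ : xsection S w = [set y : R |
  (`| `|a w| * y ^+ 2 + (- (Num.sg (a w) * b)) * y - Num.sg (a w) * c| <
   delta * `|a w|)%R]); last first.
  by apply/seteqP; split => y; rewrite xsectionE /S /f /= bc -norm_quadratic.
apply/ltW; apply: lt_le_trans (HE _ Ew _ _ _ _ _) _.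
  by split => /=; rewrite ?normr_gt0.
rewrite lee_fin sqrtrM ?(ltW delta_gt0)// mulrA mulfK; last first.
  by rewrite gt_eqF// sqrtr_gt0 normr_gt0.
rewrite sqrt_delta (_ : 2 / n%:R ^+ 2 + n%:R ^- 2 = 3 / n%:R ^+ 2)//.
by field; rewrite pnatr_eq0 -lt0n.
Qed.

End anti_concentrated_matrix.

(** [(n.-1)./2.*2] is [n-1] for odd [n] and [n-2] for even [n], and the trailing
    minor there is the one that the base condition controls. *)
Lemma probability_base_minor d (T : measurableType d) (R : realType)
    (P : probability T R) n (M : T -> 'M[R]_n) (C : R) :
  (0 < n)%N -> (forall w, (M w)^T = M w) -> base_condition P C M ->
  (P [set w | (`|\det (trailing (n.-1)./2.*2 (M w))| < (4 * C * n%:R) ^- 4)%R]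
     <= (n%:R ^- 2)%:E)%E.
Proof.
move=> n_gt0 M_sym [Modd Meven].
have [n_odd|n_even] := boolP (odd n).
  have ln : (n.-1 < n)%N by rewrite prednK.
  pose l := Ordinal ln; have lE : l.+1 = n by rewrite /= prednK.
  rewrite (_ : (n.-1)./2.*2 = l); last by rewrite /=; lia.
  under eq_set do rewrite det_trailing_last//.
  exact: Modd.
have ln : (n.-1 < n)%N by rewrite prednK.
have kn : (n.-2 < n)%N by lia.
pose l := Ordinal ln; have lE : l.+1 = n by rewrite /= prednK.
pose k := Ordinal kn; have kE : k.+2 = n by rewrite /=; lia.
rewrite (_ : (n.-1)./2.*2 = k); last by rewrite /=; lia.
rewrite [X in P X](_ : _ = [set w |
  (`|M w k k * M w l l - M w k l ^+ 2| < (4 * C * n%:R) ^- 4)%R]); last first.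
  apply/seteqP; split => w /=; rewrite (det_trailing_last2 _ kE lE) expr2;
  by rewrite (_ : M w l k = M w k l)// -[in LHS]M_sym mxE.
exact: Meven.
Qed.

Theorem lemma6p3 (d : measure_display) (T : measurableType d) (R : realType)
  (P : probability T R) (n : nat) (n_gt0 : (0 < n)%N)
  (M : T -> 'M[R]_n) (M_random : random_matrix M)
  (M_sym : forall w, (M w)^T = M w)
  (C : R) (C_ge1 : 1 <= C)
  (F : 'I_n.-1 -> set (set T))
  (F_sigma : forall i, is_sub_sigma_algebra (F i))
  (F_meas : forall (i : 'I_n.-1) (k l : 'I_n),
     ((i <= k)%N /\ (i + 2 <= l)%N) \/
     (k = l /\ (k = cur i \/ k = nxt i)) ->
     measurable_wrt (F i) (fun w => M w k l))
  (kappa : forall i : 'I_n.-1,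
     R.-pker (g_sigma_algebraType (F i)) ~> R)
  (kappa_rcd : forall i : 'I_n.-1,
     regular_conditional_distribution P
       (fun w => M w (cur i) (nxt i)) (kappa i))
  (M_anti : anti_concentration P C kappa)
  (M_base : base_condition P C M) :
  (P [set w | (`|\det (M w)| < (4 * C * n%:R) ^- (4 * n.+1))%R]
     <= (3 / n%:R)%:E)%E.
Proof.
pose m := (n.-1)./2.
pose delta : R := (4 * C ^+ 2 * n%:R ^+ 4)^-1.
pose b : R := (4 * C * n%:R) ^- 4.
have n_ge1 : 1 <= n%:R :> R by rewrite ler1n.
have n0 : 0 < n%:R :> R by rewrite ltr0n.
have C0 : 0 < C by exact: lt_le_trans C_ge1.
have mD i : measurable_fun [set: T] (fun w => \det (trailing i (M w))).
  by apply: measurable_trailing => k l _ _; exact: M_random.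
have step j : (j < m)%N -> (P [set w | (`|\det (trailing j.*2 (M w))| <
    delta * `|\det (trailing j.+1.*2 (M w))|)%R] <= (4 / n%:R ^+ 2)%:E)%E.
  move=> jm; have jn : (j.*2 < n.-1)%N by rewrite /m in jm; lia.
  exact: (probability_trailing_drop n_gt0 M_random M_sym C_ge1 F_sigma F_meas
    kappa_rcd M_anti (Ordinal jn)).
have bound := probability_descent mD (delta_gt0 n_gt0 C_ge1)
  (probability_base_minor n_gt0 M_sym M_base) step.
apply: le_trans (le_trans _ bound) _.
  apply: le_measure; rewrite ?inE.
  - apply: measurable_ltr => //; apply: measurableT_comp => //.
    by apply: measurable_det.
  - apply: measurable_ltr => //; exact: measurableT_comp.
  move=> w /=; rewrite trailing0 => /lt_le_trans; apply.
  rewrite -/delta -/m -/b exprM -exprVn -/b.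
  have b_gt0 : 0 < b by rewrite invr_gt0 exprn_gt0// !mulr_gt0.
  have b_le1 : b <= 1.
    by rewrite invf_le1 ?exprn_gt0 ?mulr_gt0// exprn_ege1//; nra.
  have b_le : b <= delta.
    rewrite lef_pV2 ?posrE ?exprn_gt0 ?mulr_gt0 ?exprn_gt0//.
    rewrite !exprMn ler_pM2r ?exprn_gt0//.
    have : C ^+ 2 <= C ^+ 4 by rewrite ler_weXn2l.
    by have := exprn_gt0 4 C0; lra.
  (* The [m] steps and the base minor cost one factor [b <= 1] each. *)
  apply: (@le_trans _ _ (b ^+ m.+1)).
    by apply: ler_wiXn2l => //; [exact: ltW|rewrite /m; lia].
  by rewrite exprSr ler_pM2r// lerXn2r// nnegrE ltW// (lt_le_trans b_gt0).
rewrite lee_fin.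
rewrite (_ : _ + _ = (1 + 4 * m%:R) / n%:R ^+ 2); last by field; rewrite gt_eqF.
rewrite ler_pdivrMr ?exprn_gt0// expr2 mulrA divfK ?gt_eqF//.
have : (1 + 4 * m <= 3 * n)%N by rewrite /m; lia.
by rewrite -(ler_nat R) natrD !natrM.
Qed.
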